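(* For every $\varepsilon>0$ there exists $c_1>0$ such that the following holds. Let $G$ be a $d$-regular graph on $n$ vertices with $d\leq n(1/2-\varepsilon)$, let $\lambda_1\geq\dots\geq\lambda_n$ be the eigenvalues of its adjacency matrix, and let $\Lambda=-\sum_{i=2}^n\lambda_i^3$. Then either $\lambda_2\geq c_1^{-1}d^{1/2}$, or $$c_1\,dn\lambda_2^2\geq \Lambda\geq \frac{nd^2}{c_1\lambda_2}.$$
   Context: Equivalently, $\Lambda=d^3-T$ where $T$ is six times the number of triangles of $G$. *)

(* Defs.v *)
From HB Require Import structures.
From mathcomp Require Import all_boot all_order all_algebra.
From mathcomp Require Import spectral complex reals.

Set Implicit Arguments.
Unset Strict Implicit.
Unset Printing Implicit Defensive.

Import Order.TTheory GRing.Theory Num.Theory.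
Local Open Scope ring_scope.

Definition simple_graph (T : finType) (e : rel T) : Prop :=
  symmetric e /\ irreflexive e.

Definition regular_graph (T : finType) (e : rel T) (d : nat) : Prop :=
  forall x : T, #|[set y | e x y]| = d.

Definition adjacency (R : realType) (T : finType) (e : rel T) : 'M[R]_#|T| :=
  \matrix_(i, j) (e (enum_val i) (enum_val j))%:R.

(* lam lists the eigenvalues of A with algebraic multiplicity, in nonincreasing
   order; its length is then n and it is uniquely determined by A. *)
Definition ordered_eigenvalues (R : realType) (n : nat) (A : 'M[R]_n)
    (lam : seq R) : Prop :=
  sorted >=%R lam /\ char_poly A = \prod_(x <- lam) ('X - x%:P).

Lemma char_poly_conj (F : fieldType) (n : nat) (P A : 'M[F]_n) :
  P \in unitmx -> char_poly (invmx P *m A *m P) = char_poly A.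
Proof.
move=> Pu; rewrite /char_poly /char_poly_mx.
have PP : map_mx polyC (invmx P) *m map_mx polyC P = 1%:M.
  by rewrite -map_mxM mulVmx // map_mx1.
rewrite !map_mxM.
have XE : 'X%:M = map_mx polyC (invmx P) *m 'X%:M *m map_mx polyC P :> 'M_n.
  by rewrite scalar_mxC -mulmxA PP mulmx1.
by rewrite {1}XE -mulmxBl -mulmxBr !det_mulmx mulrAC -det_mulmx PP det1 mul1r.
Qed.

Lemma size_ordered_eigenvalues (R : realType) (n : nat) (A : 'M[R]_n)
    (lam : seq R) : ordered_eigenvalues A lam -> size lam = n.
Proof.
case=> _ /(congr1 (fun p : {poly R} => size p)).
by rewrite size_char_poly size_prod_XsubC => -[].
Qed.

Lemma symmetric_ordered_eigenvalues (R : realType) (n : nat) (A : 'M[R]_n) :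
  A^T = A -> exists lam : seq R, ordered_eigenvalues A lam.
Proof.
move=> Asym; pose B : 'M[R[i]]_n := map_mx (real_complex R) A.
have Bherm : B \is hermsymmx.
  apply: realsym_hermsym.
    apply/is_hermitianmxP; rewrite expr0 scale1r map_mx_id //.
    by rewrite /B map_trmx Asym.
  apply/mxOverP => i j; rewrite mxE; apply/Creal_ImP.
  by rewrite -complexIm.
have Bdiag := hermitian_spectral_diag_real Bherm.
have /hermitian_normalmx/orthomx_spectralP Beq := Bherm.
pose s := [seq complex.Re (spectral_diag B 0 i) | i : 'I_n].
exists (sort >=%R s); split.
  by apply: sort_sorted => x y; apply: le_total.
rewrite (perm_big s) ?perm_sort //=.
apply: (map_inj_poly (f := real_complex R)) => //; first exact: complexI.
rewrite map_char_poly -/B Beq char_poly_conj ?spectral_unit //.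
rewrite char_poly_trig ?diag_mx_is_trig // rmorph_prod big_map big_enum /=.
apply: eq_bigr => i _; rewrite mxE eqxx mulr1n rmorphB /= map_polyX map_polyC.
congr (_ - _%:P).
have /mxOverP/(_ 0 i) /Creal_ImP := Bdiag.
rewrite -complexIm; case: (spectral_diag B 0 i) => a b [] /= ->.
by [].
Qed.

Lemma trmx_adjacency (R : realType) (T : finType) (e : rel T) :
  simple_graph e -> (adjacency R e)^T = adjacency R e.
Proof. by case=> sym_e _; apply/matrixP => i j; rewrite !mxE sym_e. Qed.

(* Main.v *)
Require Import Defs.
From mathcomp Require Import all_boot all_order all_algebra perm.
From mathcomp Require Import sesquilinear spectral complex reals ring lra.

Import Order.TTheory GRing.Theory Num.Theory.
Local Open Scope ring_scope.
Local Open Scope sesquilinear_scope.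

(** Let [L] be the second eigenvalue. If [L < c1^-1 sqrt d], then [d] is a simple
eigenvalue, with the all-ones eigenvector, so with [c := (d - L) / n] and [J]
the all-ones matrix, [B := L I - A + c J] is positive semidefinite. Testing [B]
on the two ends of an edge gives [L + 2 c >= 1], hence [L >= 2 eps]. By Schur's
product theorem the entrywise square of [B], which is
[(L^2 + 2 L c) I + (1 - 2 c) A + c^2 J], is positive semidefinite as well;
tested on the eigenvectors orthogonal to the all-ones vector it shows that every
eigenvalue is at least [- M L^2], where [M] depends only on [eps]. Together with
[\sum_(i >= 2) lambda_i = - d] and [\sum_(i >= 2) lambda_i^2 = n d - d^2] this
gives the upper bound on [Lambda]. For the lower bound, sum the inequality
[- x^3 >= 2 s x^2 + s^2 x - L (s + L)^2], valid for [x <= L] and [s >= 0], over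
the eigenvalues other than the first, with [s] a small multiple of [d / L]. *)

(** * Diagonalisation of a real symmetric matrix and power sums of its eigenvalues *)

Lemma symmetric_spectral {R : realType} {n : nat} {A : 'M[R]_n} {lam : seq R} :
  A^T = A -> ordered_eigenvalues A lam ->
  exists2 U : 'M[R[i]]_n, U \is unitarymx &
    map_mx (real_complex R) A =
    U ^t* *m diag_mx (\row_k (real_complex R lam`_k)) *m U.
Proof.
move=> Asym Alam; have szlam := size_ordered_eigenvalues Alam.
have [_ Achar] := Alam; pose B : 'M[R[i]]_n := map_mx (real_complex R) A.
have Bherm : B \is hermsymmx.
  apply: realsym_hermsym.
    apply/is_hermitianmxP; rewrite expr0 scale1r map_mx_id //.
    by rewrite /B map_trmx Asym.
  by apply/mxOverP => i j; rewrite mxE; apply/Creal_ImP; rewrite -complexIm.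
have /hermitian_normalmx/orthomx_spectralP Beq := Bherm.
set P := spectralmx B in Beq; set D := spectral_diag B in Beq.
have Puni : P \is unitarymx by apply: spectral_unitarymx.
(* The entries of [D] come in no prescribed order. Both lists consist of the roots of the
   characteristic polynomial, so a permutation of the rows of [P] aligns [D] with [lam]. *)
have permD : perm_eq (map (real_complex R) lam) [tuple D 0 i | i < n].
  apply: prod_XsubC_eq; have := congr1 (map_poly (real_complex R)) Achar.
  rewrite map_char_poly -/B Beq char_poly_conj ?unitarymx_unit //.
  rewrite char_poly_trig ?diag_mx_is_trig // rmorph_prod.
  rewrite big_map big_image /= => E.
  transitivity (\prod_(i <- lam) map_poly (real_complex R) ('X - i%:P)).
    by apply: eq_bigr => i _; rewrite rmorphB /= map_polyX map_polyC.
  by rewrite -E; apply: eq_bigr => i _; rewrite mxE eqxx mulr1n.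
have [s lamE] := tuple_permP permD.
have lamsE (k : 'I_n) : real_complex R lam`_k = D 0 (s k).
  have := congr1 (fun t => t`_k) lamE.
  rewrite (nth_map 0) ?szlam // => ->.
  rewrite (nth_map k) ?size_enum_ord //.
  by rewrite nth_ord_enum tnth_mktuple.
exists (row_perm s P).
  apply/unitarymxP.
  apply/matrixP => i j; move/unitarymxP/matrixP: Puni => /(_ (s i) (s j)).
  rewrite !mxE (inj_eq perm_inj) => <-.
  by apply: eq_bigr => k _; rewrite !mxE.
rewrite -/B Beq invmx_unitary //; apply/matrixP => i j.
rewrite !mxE (reindex_inj (@perm_inj _ s)) /=; apply: eq_bigr => k _.
rewrite !mul_mx_diag !mxE; congr (_ * _).
by rewrite lamsE.
Qed.

Lemma unitarymxC {C : numClosedFieldType} {n : nat} {U : 'M[C]_n} :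
  U \is unitarymx -> U ^t* *m U = 1%:M.
Proof. by move=> Uu; apply: mulmx1C; apply/unitarymxP. Qed.

Lemma sum_eigenvalues {R : realType} {n : nat} {A : 'M[R]_n} {lam : seq R} :
  A^T = A -> ordered_eigenvalues A lam -> \sum_(i < n) lam`_i = \tr A.
Proof.
move=> Asym /(symmetric_spectral Asym)[U Uu AE].
apply: (@complexI R); rewrite -(trace_map_mx (real_complex R)) AE.
rewrite mxtrace_mulC mulmxA (unitarymxP Uu) mul1mx mxtrace_diag rmorph_sum.
by apply: eq_bigr => i _; rewrite mxE.
Qed.

Lemma sum_sqr_eigenvalues {R : realType} {n : nat} {A : 'M[R]_n}
    {lam : seq R} :
  A^T = A -> ordered_eigenvalues A lam ->
  \sum_(i < n) lam`_i ^+ 2 = \tr (A *m A).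
Proof.
move=> Asym /(symmetric_spectral Asym)[U Uu AE].
apply: (@complexI R); rewrite -(trace_map_mx (real_complex R)) map_mxM AE.
rewrite -!mulmxA mxtrace_mulC !mulmxA !mulmxtVK //.
rewrite mulmx_diag mxtrace_diag rmorph_sum.
by apply: eq_bigr => i _; rewrite !mxE rmorphXn /= expr2.
Qed.

(** * Positive semidefinite matrices as real Gram matrices *)

Definition is_gram {R : realType} {n : nat} (B : 'M[R]_n) : Prop :=
  exists (K : finType) (f : K -> 'I_n -> R),
    forall i j, B i j = \sum_k f k i * f k j.

Lemma gram_form_ge0 {R : realType} {n : nat} {B : 'M[R]_n} (x : 'I_n -> R) :
  is_gram B -> 0 <= \sum_i \sum_j B i j * (x i * x j).
Proof.
case=> K [f BE].
suff -> : \sum_i \sum_j B i j * (x i * x j) = \sum_k (\sum_i f k i * x i) ^+ 2.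
  by apply: sumr_ge0 => k _; apply: sqr_ge0.
transitivity (\sum_i \sum_j \sum_k (f k i * x i) * (f k j * x j)).
  apply: eq_bigr => i _; apply: eq_bigr => j _.
  by rewrite BE mulr_suml; apply: eq_bigr => k _; ring.
under eq_bigr do rewrite exchange_big.
rewrite exchange_big; apply: eq_bigr => k _.
by rewrite expr2 mulr_suml; apply: eq_bigr => i _; rewrite mulr_sumr.
Qed.

(** Schur's product theorem for a square: the new Gram vectors are the tensor squares of the old
    ones, so the index set becomes [K * K]. *)
Lemma gram_hadamard_sqr {R : realType} {n : nat} {B : 'M[R]_n} :
  is_gram B -> is_gram (\matrix_(i, j) B i j ^+ 2).
Proof.
case=> K [f BE]; exists (K * K)%type, (fun k i => f k.1 i * f k.2 i) => i j.
rewrite mxE BE expr2 mulr_suml -(pair_bigA _ (fun k l =>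
  f k i * f l i * (f k j * f l j))) /=.
apply: eq_bigr => k _; rewrite mulr_sumr; apply: eq_bigr => l _; ring.
Qed.

(* The real and imaginary parts of the rows of [U] are the Gram vectors. *)
Lemma gram_diag {R : realType} {n : nat} {B : 'M[R]_n} (U : 'M[R[i]]_n)
    (b : 'I_n -> R) :
  (forall k, 0 <= b k) ->
  map_mx (real_complex R) B =
    U ^t* *m diag_mx (\row_k real_complex R (b k)) *m U ->
  is_gram B.
Proof.
move=> b0 /matrixP BE.
pose f (k : 'I_n * bool) i :=
  Num.sqrt (b k.1) *
    (if k.2 then complex.Re (U k.1 i) else complex.Im (U k.1 i)).
exists ('I_n * bool)%type, f => i j.
transitivity (complex.Re (map_mx (real_complex R) B i j)); first by rewrite mxE.
rewrite BE mxE (big_morph (@complex.Re R) (id1 := 0) (op1 := +%R)) //;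
  last by move=> [? ?] [? ?].
rewrite -(pair_bigA _ (fun k c => f (k, c) i * f (k, c) j)) /=.
apply: eq_bigr => k _; rewrite mul_mx_diag !mxE big_bool /f /=.
move: (Num.sqrt (b k)) (sqr_sqrtr (b0 k)) => t <-.
case: (U k i) => p q; case: (U k j) => r s /=; ring.
Qed.

(** * Top eigenvalue of a nonnegative matrix with constant column sums *)

Lemma eigenvalue_le_colsum {R : realType} {n : nat} {A : 'M[R]_n} {d a : R}
    {v : 'rV[R]_n} :
  (forall i j, 0 <= A i j) -> (forall j, \sum_i A i j = d) ->
  v *m A = a *: v -> v != 0 -> `|a| <= d.
Proof.
move=> A0 Ad vA /eqP v0.
have [i0 vi0] : exists i0, v 0 i0 != 0.
  apply/existsP; apply: contra_notT v0; rewrite negb_exists => /forallP v0.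
  by apply/rowP => i; rewrite mxE; apply/eqP; have := v0 i; rewrite negbK.
(* The eigenvector equation is compared at an entry of [v] of largest modulus. *)
pose i := [arg max_(i > i0) `|v 0 i|]%O.
have vi j : `|v 0 j| <= `|v 0 i|.
  by rewrite /i; case: arg_maxP => // k _; apply.
have vi_gt0 : 0 < `|v 0 i| by apply: lt_le_trans (vi i0); rewrite normr_gt0.
have := congr1 (fun w : 'rV_n => `|w 0 i|) vA.
rewrite !mxE normrM => E; rewrite -(ler_pM2r vi_gt0) -E -(Ad i) mulr_suml.
apply: le_trans (ler_norm_sum _ _ _) _; apply: ler_sum => j _.
by rewrite normrM (ger0_norm (A0 _ _)) mulrC ler_wpM2l.
Qed.

Lemma ordered_eigenvalues_le {R : realType} {n : nat} {A : 'M[R]_n}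
    {lam : seq R} {i j : nat} :
  ordered_eigenvalues A lam -> (i <= j < n)%N -> lam`_j <= lam`_i.
Proof.
move=> Alam /andP[leij ltjn]; have sz := size_ordered_eigenvalues Alam.
have [slam _] := Alam.
have ge_trans : transitive (>=%R : rel R).
  by move=> x y z /= yx zy; apply: le_trans zy yx.
apply: (sorted_leq_nth ge_trans (@lexx _ R) 0 slam _ _ _ _ leij).
  by rewrite inE sz (leq_ltn_trans leij).
by rewrite inE sz.
Qed.

Lemma ordered_eigenvaluesP {R : realType} {n : nat} {A : 'M[R]_n}
    {lam : seq R} {a : R} :
  ordered_eigenvalues A lam ->
  reflect (exists2 v : 'rV_n, v *m A = a *: v & v != 0) (a \in lam).
Proof.
case=> _ Achar; rewrite -root_prod_XsubC -Achar -eigenvalue_root_char.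
exact: eigenvalueP.
Qed.

Lemma mulmx_const1_colsum {R : realType} {n : nat} {A : 'M[R]_n} {d : R} :
  (forall j, \sum_i A i j = d) ->
  const_mx 1 *m A = d *: (const_mx 1 : 'rV_n).
Proof.
move=> Ad; apply/rowP => j; rewrite !mxE mulr1 -(Ad j).
by apply: eq_bigr => i _; rewrite mxE mul1r.
Qed.

Lemma top_eigenvalue {R : realType} {n : nat} {A : 'M[R]_n} {lam : seq R}
    {d : R} :
  (0 < n)%N -> (forall i j, 0 <= A i j) -> (forall j, \sum_i A i j = d) ->
  ordered_eigenvalues A lam -> lam`_0 = d.
Proof.
move=> n0 A0 Ad Alam; have sz := size_ordered_eigenvalues Alam.
apply/eqP; rewrite eq_le; apply/andP; split.
  have /(ordered_eigenvaluesP Alam)[v vA v0] : lam`_0 \in lam.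
    by rewrite mem_nth ?sz.
  exact: le_trans (ler_norm _) (eigenvalue_le_colsum A0 Ad vA v0).
have : d \in lam.
  apply/(ordered_eigenvaluesP Alam).
  exists (const_mx 1); first exact: mulmx_const1_colsum.
  apply/eqP => /rowP/(_ (Ordinal n0)); rewrite !mxE => /eqP.
  by rewrite oner_eq0.
move/(nthP 0) => [j ltj <-].
by apply: (ordered_eigenvalues_le Alam); rewrite -sz.
Qed.

(* As [lam`_1 < d], the eigenvalue [d] is simple, so the all-ones matrix is [n]
   times the projection onto the first eigenvector, and adding a multiple of it
   changes only the first eigenvalue of [lam`_1%:M - A], from [lam`_1 - d]
   to [0]. *)
Lemma gram_second_eigenvalue {R : realType} {n : nat} {A : 'M[R]_n}
    {lam : seq R} {d : R} :
  (0 < n)%N -> A^T = A -> (forall j, \sum_i A i j = d) ->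
  ordered_eigenvalues A lam -> lam`_0 = d -> lam`_1 < d ->
  is_gram ((lam`_1)%:M - A + const_mx ((d - lam`_1) / n%:R)).
Proof.
move=> n0 Asym Ad Alam lam0 lam1.
have [U Uu AE] := symmetric_spectral Asym Alam.
set D := diag_mx _ in AE.
pose o : 'rV[R[i]]_n := const_mx 1.
have [w wE] : exists w, w = o *m U ^t* by exists (o *m U ^t*).
have oE : o = w *m U by rewrite wE -mulmxA (unitarymxC Uu) mulmx1.
have oA : o *m map_mx (real_complex R) A = real_complex R d *: o.
  rewrite /o -(map_const_mx (real_complex R)) -map_mxM (mulmx_const1_colsum Ad).
  by rewrite map_mxZ.
have wD : w *m D = real_complex R d *: w.
  rewrite wE scalemxAl -oA AE !mulmxA -(mulmxA _ U) (unitarymxP Uu).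
  by rewrite mulmx1.
(* [w] holds the coordinates of the all-ones vector in the eigenbasis. Only the first can be
   nonzero, since all later eigenvalues are below [d]. *)
have w_eq0 (k : 'I_n) : val k != 0%N -> w 0 k = 0.
  move=> k0; move/rowP/(_ k): wD; rewrite mul_mx_diag !mxE => /eqP.
  rewrite mulrC -subr_eq0 -mulrBl mulf_eq0 => /orP[|/eqP//].
  rewrite subr_eq0 => /eqP/complexI lamk.
  suff : lam`_k <= lam`_1 by rewrite lamk leNgt lam1.
  by apply: (ordered_eigenvalues_le Alam); rewrite lt0n k0 /=.
have wwE :
    w ^t* *m w = diag_mx (\row_k real_complex R (n%:R *+ (val k == 0%N))).
  (* The unitary change of basis preserves the squared length [n] of the all-ones vector. *)
  have ww : \sum_k w 0 k * (w 0 k)^* = n%:R.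
    have -> : \sum_k w 0 k * (w 0 k)^* = (w *m w ^t*) 0 0.
      by rewrite mxE; apply: eq_bigr => k _; rewrite !mxE.
    rewrite {2}wE trmx_mul map_mxM /= trmxCK mulmxA -oE mxE.
    under eq_bigr do rewrite !mxE rmorph1 mulr1.
    by rewrite sumr_const card_ord.
  apply/matrixP => i j; rewrite !mxE big_ord1 !mxE.
  have [k0|i0] := eqVneq (val i) 0%N; last first.
    by rewrite (w_eq0 i) // rmorph0 mul0r mulr0n rmorph0 mul0rn.
  have [<-|neij] := eqVneq i j; last first.
    rewrite (w_eq0 j) ?mulr0 //; apply: contra_neq neij => j0.
    by apply: val_inj; rewrite k0 j0.
  rewrite mulr1n rmorph_nat -ww (bigD1 i) //= big1 ?addr0 1?mulrC // => k neki.
  rewrite (w_eq0 k) ?mul0r //; apply: contra_neq neki => k0'.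
  by apply: val_inj; rewrite k0 k0'.
pose b (k : 'I_n) := lam`_1 - lam`_k + (d - lam`_1) *+ (val k == 0%N).
apply: (gram_diag U b) => [k|].
  rewrite /b; have [->|k0] := eqVneq (val k) 0%N.
    by rewrite lam0 mulr1n; lra.
  rewrite mulr0n addr0 subr_ge0.
  by apply: (ordered_eigenvalues_le Alam); rewrite lt0n k0 /=.
have JE : const_mx 1 = U ^t* *m (w ^t* *m w) *m U.
  have -> : const_mx 1 = o ^t* *m o.
    by apply/matrixP => i j; rewrite !mxE big_ord1 !mxE rmorph1 mulr1.
  by rewrite {1 2}oE trmx_mul map_mxM /= !mulmxA.
have -> : map_mx (real_complex R)
      ((lam`_1)%:M - A + const_mx ((d - lam`_1) / n%:R)) =
    (real_complex R lam`_1)%:M - map_mx (real_complex R) A +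
      real_complex R ((d - lam`_1) / n%:R) *: const_mx 1.
  by apply/matrixP => i j; rewrite !mxE rmorphD rmorphB rmorphMn mulr1.
rewrite AE JE wwE -(mulmx1 (_%:M)) -(unitarymxC Uu) mulmxA -scalar_mxC.
rewrite scalemxAl scalemxAr -mulmxBl -mulmxDl -mulmxBr -mulmxDr.
congr (_ *m _ *m _); apply/matrixP => i j; rewrite !mxE.
have [_|_] := eqVneq i j; last by rewrite !mulr0n mulr0; ring.
rewrite !mulr1n /b -rmorphM -rmorphB -rmorphD; congr (real_complex R (_ + _)).
case: eqP => _; last by rewrite !mulr0n mulr0.
by rewrite !mulr1n divfK // pnatr_eq0 -lt0n.
Qed.

(** This is the quadratic form of [B] at the sum of the basis vectors [i] and [j]. *)
Lemma gram_pair_ge0 {R : realType} {n : nat} {B : 'M[R]_n} (i j : 'I_n) :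
  is_gram B -> 0 <= B i i + B j j + 2 * B i j.
Proof.
case=> K [f BE].
suff -> : B i i + B j j + 2 * B i j = \sum_k (f k i + f k j) ^+ 2.
  by apply: sumr_ge0 => k _; apply: sqr_ge0.
rewrite !BE mulr_sumr -!big_split; apply: eq_bigr => k _ /=; ring.
Qed.

(* The Hadamard square of [L%:M - A + const_mx c] is a combination of the
   identity, [A] and the all-ones matrix, because [A] has entries 0 and 1. *)
Lemma eigenvalue_ge_hadamard_sqr {R : realType} {n : nat} {A : 'M[R]_n}
    {L c a : R} {v : 'rV[R]_n} :
  (forall i j, A i j ^+ 2 = A i j) -> (forall i, A i i = 0) ->
  is_gram (L%:M - A + const_mx c) ->
  v *m A = a *: v -> v != 0 -> \sum_i v 0 i = 0 ->
  0 <= L ^+ 2 + 2 * L * c + (1 - 2 * c) * a.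
Proof.
move=> A01 Aii /gram_hadamard_sqr /(gram_form_ge0 (fun i => v 0 i)).
move=> + vA vn0 vsum.
have vA_ j : \sum_i v 0 i * A i j = a * v 0 j.
  by move/rowP/(_ j): vA; rewrite !mxE.
have v2_gt0 : 0 < \sum_j v 0 j ^+ 2.
  rewrite lt_neqAle eq_sym sumr_ge0 ?andbT => [|j _]; last exact: sqr_ge0.
  apply: contra_neq vn0 => /eqP.
  rewrite psumr_eq0 => [|j _]; last exact: sqr_ge0.
  move/allP => v0; apply/rowP => j; rewrite mxE; apply/eqP.
  by have := v0 j (mem_index_enum j); rewrite sqrf_eq0.
suff -> : \sum_i \sum_j
    (\matrix_(i, j) (L%:M - A + const_mx c) i j ^+ 2) i j * (v 0 i * v 0 j) =
    (L ^+ 2 + 2 * L * c + (1 - 2 * c) * a) * \sum_j v 0 j ^+ 2.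
  by rewrite pmulr_lge0.
transitivity (\sum_j \sum_i (((L ^+ 2 + 2 * L * c) * v 0 j ^+ 2 *+ (i == j)) +
    ((1 - 2 * c) * v 0 j * (v 0 i * A i j) + c ^+ 2 * v 0 j * v 0 i))).
  rewrite exchange_big; apply: eq_bigr => j _; apply: eq_bigr => i _.
  rewrite !mxE; have [->|nij] := eqVneq i j; first by rewrite Aii !mulr1n; ring.
  have -> : (L *+ false - A i j + c) ^+ 2 =
      A i j ^+ 2 - 2 * c * A i j + c ^+ 2 by rewrite mulr0n; ring.
  by rewrite A01 mulr0n; ring.
rewrite mulr_sumr; apply: eq_bigr => j _.
(* The all-ones term, with coefficient [c ^+ 2], disappears because the entries of [v] sum to
   zero. *)
rewrite !big_split /= -!mulr_sumr vsum vA_ (bigD1 j) //= eqxx big1 => [|i].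
  by rewrite mulr1n; ring.
by move/negbTE ->.
Qed.

(** * Bounds on cubes and their sums *)

Lemma neg_cube_ge {R : realType} {s L x : R} :
  0 <= s -> 0 <= L -> x <= L ->
  2 * s * x ^+ 2 + s ^+ 2 * x - L * (s + L) ^+ 2 <= - x ^+ 3.
Proof.
move=> s0 L0 xL.
(* The two sides differ by [L (s + L)^2 - x (s + x)^2]. *)
suff : x * (s + x) ^+ 2 <= L * (s + L) ^+ 2 by lra.
have [x0|x0] := leP x 0.
  apply: (@le_trans _ _ 0); first by rewrite mulr_le0_ge0 // sqr_ge0.
  by rewrite mulr_ge0 // sqr_ge0.
apply: ler_pM; rewrite ?sqr_ge0 ?(ltW x0) //.
by rewrite ler_sqr ?nnegrE; lra.
Qed.

Lemma sum_neg_cube_le {R : realType} {n : nat} {x : nat -> R} {M : R} :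
  (forall i, (0 < i < n)%N -> - x i <= M) ->
  - \sum_(1 <= i < n) x i ^+ 3 <= M * \sum_(1 <= i < n) x i ^+ 2.
Proof.
move=> xM; rewrite -sumrN mulr_sumr; apply: ler_sum_nat => i /xM xiM.
have := ler_wpM2r (sqr_ge0 (x i)) xiM; lra.
Qed.

Lemma sum_neg_cube_ge {R : realType} {n : nat} {x : nat -> R} {s L : R} :
  0 <= s -> 0 <= L -> (forall i, (0 < i < n)%N -> x i <= L) ->
  2 * s * \sum_(1 <= i < n) x i ^+ 2 + s ^+ 2 * \sum_(1 <= i < n) x i
    - n%:R * (L * (s + L) ^+ 2) <= - \sum_(1 <= i < n) x i ^+ 3.
Proof.
move=> s0 L0 xL.
apply: (@le_trans _ _ (\sum_(1 <= i < n)
    (2 * s * x i ^+ 2 + s ^+ 2 * x i - L * (s + L) ^+ 2))).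
  rewrite !big_split /= -!mulr_sumr sumrN lerD2l lerN2 sumr_const_nat.
  rewrite -[leLHS]mulr_natl.
  (* The sum has at most [n - 1] terms; as the subtracted constant is nonnegative, it may be counted
     [n] times. *)
  rewrite ler_wpM2r ?ler_nat ?leq_subr //.
  by rewrite mulr_ge0 // sqr_ge0.
by rewrite -sumrN; apply: ler_sum_nat => i /xL xiL; apply: neg_cube_ge.
Qed.

(** * Row sums and eigenvectors orthogonal to the all-ones vector *)

Lemma adjacency_rowsum {R : realType} {T : finType} {e : rel T} {d : nat} i :
  regular_graph e d -> \sum_j adjacency R e i j = d%:R.
Proof.
move=> reg; under eq_bigr do rewrite mxE.
rewrite -(big_enum_val (fun y => (e (enum_val i) y)%:R)) /=.
rewrite -natr_sum -(reg (enum_val i)) -sum1_card; congr _%:R.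
by rewrite [RHS]big_mkcond; apply: eq_bigr => y _; rewrite inE; case: (e _ _).
Qed.

(** Adding up the entries of both sides of [v *m A = a *: v] gives [d] and [a] times the same
    sum. *)
Lemma eigenvector_sum0 {R : realType} {n : nat} {A : 'M[R]_n} {d a : R}
    {v : 'rV[R]_n} :
  (forall i, \sum_j A i j = d) -> v *m A = a *: v -> a != d ->
  \sum_i v 0 i = 0.
Proof.
move=> Ad vA nad.
have : a * \sum_i v 0 i = d * \sum_i v 0 i.
  rewrite !mulr_sumr.
  transitivity (\sum_j (v *m A) 0 j).
    by apply: eq_bigr => j _; rewrite vA mxE.
  under eq_bigr do rewrite mxE.
  rewrite exchange_big; apply: eq_bigr => i _ /=.
  by rewrite -mulr_sumr Ad mulrC.
by move/eqP; rewrite -subr_eq0 -mulrBl mulf_eq0 subr_eq0 (negbTE nad) => /eqP.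
Qed.

(** * Estimates for the second eigenvalue, the negative eigenvalues and the cubic sum *)

Lemma second_eigenvalue_ge {R : realType} {n : nat} {A : 'M[R]_n}
    {lam : seq R} {d eps : R} (i j : 'I_n) :
  (2 < n)%N -> 0 < eps -> d <= n%:R * (1 / 2 - eps) ->
  A i i = 0 -> A j j = 0 -> A i j = 1 -> i != j ->
  is_gram ((lam`_1)%:M - A + const_mx ((d - lam`_1) / n%:R)) ->
  2 * eps <= lam`_1.
Proof.
move=> n2 eps0 dn Aii Ajj Aij nij /(gram_pair_ge0 i j).
rewrite !mxE Aii Ajj Aij !eqxx (negbTE nij) mulr0n !mulr1n.
have n_gt2 : 2 < n%:R :> R by rewrite ltr_nat.
set L := lam`_1; set c := _ / _ => cL.
have cn : c * n%:R = d - L by rewrite /c divfK // gt_eqF //; lra.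
have : 0 <= (L + 2 * c - 1) * n%:R by rewrite mulr_ge0; lra.
have -> : (L + 2 * c - 1) * n%:R = L * n%:R + 2 * (c * n%:R) - n%:R by ring.
rewrite cn => H.
(* Clearing the denominator of [c] in [L + 2 * c >= 1] gives [L (n - 2) >= n - 2 d]. As [n > 2],
   this forces [L > 0], and then [n - 2] can be enlarged to [n]. *)
have Ln : 2 * eps * n%:R <= L * (n%:R - 2) by lra.
have L0 : 0 < L.
  rewrite -(pmulr_lgt0 (x := n%:R - 2)); last by lra.
  by apply: lt_le_trans Ln; rewrite !mulr_gt0 //; lra.
by rewrite -(@ler_pM2r _ n%:R); lra.
Qed.

(** For [a < 0], the bound on [c] gives [1 - 2 c >= 2 eps] and [2 c <= 1], so
    [2 eps (- a) <= L^2 + L]; finally [L <= L^2 / (2 eps)] because [L >= 2 eps]. *)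
Lemma neg_eigenvalue_le {R : realType} (c : R) {L a eps : R} :
  0 < eps -> 2 * eps <= L -> c <= 1 / 2 - eps ->
  0 <= L ^+ 2 + 2 * L * c + (1 - 2 * c) * a ->
  - a <= (1 + (2 * eps)^-1) / (2 * eps) * L ^+ 2.
Proof.
move=> eps0 epsL cle H.
have [a0|a0] := leP 0 a.
  apply: (@le_trans _ _ 0); first by lra.
  by rewrite mulr_ge0 ?sqr_ge0 // divr_ge0 ?addr_ge0 ?invr_ge0; lra.
have LL : L <= (2 * eps)^-1 * L ^+ 2.
  rewrite mulrC ler_pdivlMr ?mulr_gt0 // expr2 ler_wpM2l //; lra.
rewrite mulrAC ler_pdivlMr; last by lra.
have ca : 0 <= (1 / 2 - eps - c) * - a by rewrite mulr_ge0; lra.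
have cL : 0 <= (1 / 2 - c) * L by rewrite mulr_ge0; lra.
lra.
Qed.

(** With [Q = n d^2 / L] and [s = k d / L], the main term is at least [k Q], and the losses are at
    most [4 k^2 Q] and [k^2 Q / (4 eps)]. The condition on [k] bounds their sum by [k Q / 2], and
    what remains is at least [Q / c1] since [c1 k >= 2]. *)
Lemma cubic_lower_bound {R : realType} (eps k : R) {c1 n d L Lam : R} :
  0 < eps -> 0 < k -> k * (8 + (2 * eps)^-1) <= 1 -> 2 <= c1 * k -> 0 < c1 ->
  0 < n -> 0 < d -> d <= n / 2 -> 2 * eps <= L -> L ^+ 2 <= k * d ->
  (forall s : R, 0 <= s ->
    2 * s * (n * d - d ^+ 2) + s ^+ 2 * - d - n * (L * (s + L) ^+ 2) <= Lam) ->
  n * d ^+ 2 / (c1 * L) <= Lam.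
Proof.
move=> eps0 k0 kle kc1 c10 n0 d0 dn epsL L2 Hs.
have L0 : 0 < L by lra.
(* This [s] is of the order of the maximiser of the lower bound. *)
pose s := k * d / L; have s0 : 0 < s by rewrite divr_gt0 // mulr_gt0.
have sL : s * L = k * d by rewrite /s divfK // gt_eqF.
(* The smallness of [L] against the square root of [d] enters here; it allows [s + L] to be replaced
   by [2 s]. *)
have Ls : L <= s by rewrite -(ler_pM2r L0) sL -expr2.
apply: le_trans (Hs s (ltW s0)).
pose Q := n * d ^+ 2 / L.
have Q0 : 0 < Q by rewrite divr_gt0 // mulr_gt0 // exprn_gt0.
have E1 : s * n * d = k * Q by rewrite /s /Q; field; rewrite gt_eqF.
have E2 : n * L * s ^+ 2 = k ^+ 2 * Q by rewrite /s /Q; field; rewrite gt_eqF.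
have -> : n * d ^+ 2 / (c1 * L) = Q / c1.
  by rewrite /Q; field; rewrite !gt_eqF.
clearbody s Q.
have B1 : s * n * d <= 2 * s * (n * d - d ^+ 2).
  have -> : 2 * s * (n * d - d ^+ 2) = s * n * d + 2 * (s * d * (n / 2 - d)).
    by field.
  have : 0 <= s * d * (n / 2 - d) by rewrite !mulr_ge0 //; lra.
  lra.
have B2 : n * (L * (s + L) ^+ 2) <= 4 * (k ^+ 2 * Q).
  rewrite -E2 mulrA.
  have -> : 4 * (n * L * s ^+ 2) = n * L * (s + s) ^+ 2 by ring.
  by rewrite ler_pM2l ?mulr_gt0 // ler_sqr ?nnegrE; lra.
have B3 : s ^+ 2 * d <= (2 * eps)^-1 / 2 * (k ^+ 2 * Q).
  (* From [d <= n / 2] and [2 eps <= L], the term [s^2 d] becomes comparable with [n L s^2]. *)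
  have : d * (4 * eps) <= n * L.
    apply: (@le_trans _ _ (n * (2 * eps))); last by rewrite ler_pM2l.
    have : 0 <= (n / 2 - d) * eps by rewrite mulr_ge0; lra.
    lra.
  move/(ler_wpM2l (sqr_ge0 s)).
  have -> : s ^+ 2 * (n * L) = k ^+ 2 * Q by rewrite -E2; ring.
  have -> : (2 * eps)^-1 / 2 * (k ^+ 2 * Q) = k ^+ 2 * Q / (4 * eps).
    by field; rewrite gt_eqF.
  by move=> H; rewrite ler_pdivlMr ?mulr_gt0 // -[leLHS]mulrA.
have kQ : k * (k * (8 + (2 * eps)^-1)) * Q <= k * Q.
  by rewrite ler_pM2r // ger_pMr.
have : Q / c1 <= k / 2 * Q.
  by rewrite mulrC ler_pM2r // -div1r ler_pdivrMr //; lra.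
lra.
Qed.

(** * Traces of the adjacency matrix and of its square *)

Lemma mxtrace_adjacency {R : realType} {T : finType} {e : rel T} :
  irreflexive e -> \tr (adjacency R e) = 0.
Proof. by move=> irr; apply: big1 => i _; rewrite mxE irr. Qed.

Lemma mxtrace_adjacency_sqr {R : realType} {T : finType} {e : rel T} {d : nat} :
  symmetric e -> regular_graph e d ->
  \tr (adjacency R e *m adjacency R e) = #|T|%:R * d%:R.
Proof.
move=> sym reg; transitivity (\sum_(i < #|T|) (d%:R : R)); last first.
  by rewrite sumr_const card_ord mulr_natl.
apply: eq_bigr => i _; rewrite mxE -(adjacency_rowsum i reg).
by apply: eq_bigr => j _; rewrite !mxE (sym (enum_val j));
  case: (e _ _); rewrite ?mulr1 ?mulr0.
Qed.

(** * Choice of the constants and assembly of the two bounds *)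

Theorem theorem7p3 (R : realType) (eps : R) (heps : 0 < eps) :
  exists2 c1 : R, 0 < c1 &
    forall (T : finType) (e : rel T) (d n : nat) (lam : seq R),
      simple_graph e -> regular_graph e d -> #|T| = n ->
      d%:R <= n%:R * (1 / 2 - eps) ->
      ordered_eigenvalues (adjacency R e) lam ->
      (* lam is indexed from 0, so the informal lambda_i is lam`_(i - 1) *)
      let lam2 := lam`_1 in
      let Lambda := - \sum_(1 <= i < n) lam`_i ^+ 3 in
      lam2 >= c1^-1 * Num.sqrt d%:R \/
      (c1 * d%:R * n%:R * lam2 ^+ 2 >= Lambda /\
       Lambda >= n%:R * d%:R ^+ 2 / (c1 * lam2)).
Proof.
pose k := (8 + (2 * eps)^-1)^-1; pose M := (1 + (2 * eps)^-1) / (2 * eps).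
have ieps0 : 0 < (2 * eps)^-1 by rewrite invr_gt0; lra.
have k0 : 0 < k by rewrite invr_gt0; lra.
have k1 : k * (8 + (2 * eps)^-1) = 1 by rewrite mulVf // gt_eqF //; lra.
have M0 : 0 < M by rewrite divr_gt0; lra.
have ik0 : 0 < k^-1 by rewrite invr_gt0.
(* The three summands guarantee [c1 >= 1], [c1 k >= 2] and [c1 >= M]. *)
exists (1 + 2 / k + M) => [|T e d n lam Ge reg <- {n} dn Alam]; first by lra.
set c1 := 1 + 2 / k + M; set N := #|T| in dn Alam *.
have c10 : 0 < c1 by rewrite /c1; lra.
have c11 : 1 <= c1 by rewrite /c1; lra.
have c1M : M <= c1 by rewrite /c1; lra.
have c1k : 2 <= c1 * k.
  have -> : c1 * k = 2 + (1 + M) * k by rewrite /c1; field; rewrite gt_eqF.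
  by rewrite lerDl mulr_ge0; lra.
clearbody k c1 => lam2 Lambda.
have [sym irr] := Ge; have Asym := trmx_adjacency R Ge.
pose A := adjacency R e; rewrite -/A in Alam Asym.
have Arow i : \sum_j A i j = d%:R by apply: adjacency_rowsum.
have Acol j : \sum_i A i j = d%:R.
  by rewrite -(Arow j); apply: eq_bigr => i _; rewrite -{1}Asym mxE.
have A0 i j : 0 <= A i j by rewrite mxE ler0n.
have A01 i j : A i j ^+ 2 = A i j.
  by rewrite mxE; case: (e _ _); rewrite ?expr1n ?expr0n.
have Aii i : A i i = 0 by rewrite mxE irr.
have sz := size_ordered_eigenvalues Alam.
have [lt2|ge2] := lerP (c1^-1 * Num.sqrt d%:R) lam2; first by left.
right.
have d_gt0 : (0 < d)%N.
  rewrite lt0n; apply: contraTneq ge2 => d0.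
  rewrite d0 sqrtr0 mulr0 -leNgt /lam2.
  (* If [d = 0], then [lam2] is zero: either every eigenvalue vanishes, or there are fewer than two
     of them and [lam2] is the default value 0. The first alternative would then hold. *)
  have [szlt|szge] := ltnP 1 (size lam); last by rewrite nth_default.
  have /(ordered_eigenvaluesP Alam)[v vA v0] := mem_nth 0 szlt.
  have := eigenvalue_le_colsum A0 Acol vA v0.
  by rewrite d0 normr_le0 => /eqP->.
have d1 : 1 <= d%:R :> R by rewrite ler1n.
have N0 : 0 <= N%:R :> R by rewrite ler0n.
have dN : d%:R < N%:R / 2 :> R.
  have [N0'|N0'] := eqVneq (N%:R : R) 0; first by rewrite N0' mul0r in dn; lra.
  have : 0 < N%:R * eps by rewrite mulr_gt0 // lt_neqAle eq_sym N0'.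
  lra.
have N2 : (2 < N)%N by rewrite -(ltr_nat R); lra.
have N_pos : (0 < N)%N by apply: ltn_trans N2.
have lam0 : lam`_0 = d%:R.
  by apply: (top_eigenvalue N_pos A0 Acol Alam).
have sqrt_d : Num.sqrt d%:R ^+ 2 = d%:R :> R by rewrite sqr_sqrtr // ler0n.
have sqrt_d0 : 0 <= Num.sqrt d%:R :> R by apply: sqrtr_ge0.
(* Since [c1 >= 1] and [d >= 1], both [c1^-1 sqrt d <= sqrt d] and [sqrt d <= d] hold. *)
have lam1 : lam2 < d%:R.
  apply: lt_le_trans ge2 _; apply: (@le_trans _ _ (Num.sqrt d%:R)).
    by rewrite ler_piMl // invf_le1.
  by rewrite -[leRHS]sqrt_d expr2 ler_peMl // -[leLHS]sqrtr1 ler_wsqrtr.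
have gramB := gram_second_eigenvalue N_pos Asym Acol Alam lam0 lam1.
have [x [y exy]] : exists x y, e x y.
  have x : T := enum_val (Ordinal N_pos).
  have /set0Pn[y] : [set y | e x y] != set0 by rewrite -card_gt0 reg.
  by rewrite inE; exists x, y.
have eps_lam2 : 2 * eps <= lam2.
  apply: (second_eigenvalue_ge (enum_rank x) (enum_rank y) N2 heps dn (Aii _)
    (Aii _) _ _ gramB).
    by rewrite mxE !enum_rankK exy.
  by apply: contraTneq exy => /enum_rank_inj ->; rewrite irr.
have lam2_gt0 : 0 < lam2 by apply: lt_le_trans eps_lam2; lra.
have N_gt0 : 0 < N%:R :> R by lra.
have lam_le i : (0 < i < N)%N -> lam`_i <= lam2.
  by move=> ?; apply: (ordered_eigenvalues_le Alam).
have lam_ge i : (0 < i < N)%N -> - lam`_i <= M * lam2 ^+ 2.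
  move=> iN; have /andP[_ ltiN] := iN.
  have lami : lam`_i \in lam by rewrite mem_nth // sz.
  have /(ordered_eigenvaluesP Alam)[v vA v0] := lami.
  have lam_neqd : lam`_i != d%:R.
    by rewrite lt_eqF // (le_lt_trans (lam_le i iN)).
  apply: (neg_eigenvalue_le ((d%:R - lam2) / N%:R)) => //.
    by rewrite ler_pdivrMr // mulrC; lra.
  apply: (eigenvalue_ge_hadamard_sqr A01 Aii gramB vA v0).
  exact: eigenvector_sum0 Arow vA lam_neqd.
have sum_split (F : R -> R) :
    \sum_(1 <= i < N) F lam`_i = \sum_(i < N) F lam`_i - F d%:R.
  rewrite -(big_mkord xpredT (fun i => F lam`_i)) [in RHS]big_ltn ?lam0.
    by rewrite addrC addKr.
  exact: N_pos.
have S1 : \sum_(1 <= i < N) lam`_i = - d%:R.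
  rewrite (sum_split id) /= (sum_eigenvalues Asym Alam).
  by rewrite mxtrace_adjacency // sub0r.
have S2 : \sum_(1 <= i < N) lam`_i ^+ 2 = N%:R * d%:R - d%:R ^+ 2.
  rewrite (sum_split (fun x => x ^+ 2)) (sum_sqr_eigenvalues Asym Alam).
  by rewrite (mxtrace_adjacency_sqr sym reg).
split.
  apply: le_trans (sum_neg_cube_le lam_ge) _; rewrite S2.
  have -> : c1 * d%:R * N%:R * lam2 ^+ 2 =
      c1 * lam2 ^+ 2 * (N%:R * d%:R) by ring.
  apply: ler_pM; last by rewrite lerBlDr lerDl sqr_ge0.
  - by rewrite mulr_ge0 ?sqr_ge0 // ltW.
  - rewrite subr_ge0 expr2 ler_pM2r; lra.
  - by rewrite ler_wpM2r ?sqr_ge0.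
apply: (cubic_lower_bound eps k) => //; rewrite ?k1 //; try lra.
  have : lam2 ^+ 2 <= (c1^-1 * Num.sqrt d%:R) ^+ 2.
    by rewrite ler_sqr ?nnegrE ?(ltW ge2) ?(ltW lam2_gt0)
       ?mulr_ge0 ?invr_ge0 ?(ltW c10).
  move/le_trans; apply; rewrite exprMn sqrt_d ler_pM2r; last by lra.
  rewrite exprVn -div1r ler_pdivrMr ?exprn_gt0 //.
  (* The required [c1^-2 <= k] follows from [1 <= c1 k <= c1^2 k]. *)
  apply: (@le_trans _ _ (c1 * k)); first by lra.
  by rewrite mulrC ler_pM2l // expr2 ler_peMl // ltW.
move=> s s0; rewrite -S1 -S2.
exact: sum_neg_cube_ge s0 (ltW lam2_gt0) lam_le.
Qed.
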